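(* Let $\alpha,\beta,\gamma,\epsilon$ be real parameters. Define the operators $$\kappa_1=\mathcal{D}^{(\epsilon)},\qquad \kappa_2=x,\qquad P=R+\frac{\gamma}{x}(\mathbb{I}-R),\qquad \kappa_3=[\kappa_1,\kappa_2],$$ where $\kappa_2$ is multiplication by $x$ and $\mathcal{D}^{(\epsilon)}$ is the second-order differential Dunkl operator given in the context. Then $P^2=\mathbb{I}$, and the following relations hold: $$[\kappa_3,\kappa_2]=\tfrac12\kappa_2^2+\delta_2\kappa_2^2P+2\delta_3\kappa_3P-\delta_5P-\delta_4,$$ $$[\kappa_1,\kappa_3]=\tfrac12\{\kappa_1,\kappa_2\}-\delta_2\kappa_3P-\delta_3\kappa_1P+\delta_1\kappa_2-\delta_1\delta_3P,$$ $$[\kappa_1,P]=0,\qquad \{\kappa_2,P\}=2\delta_3,\qquad \{\kappa_3,P\}=0,$$ with structure constants $$\delta_1=\epsilon(\alpha+\beta+1-\epsilon),\quad \delta_2=\alpha+\beta+\tfrac32-2\epsilon,\quad \delta_3=\gamma,\quad \delta_4=\frac{\gamma^2+1}{2},$$ $$\delta_5=\gamma^2\left(\alpha+\beta+\tfrac32-2\epsilon\right)+\alpha+\tfrac12 .$$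
   Context: $[a,b]=ab-ba$ and $\{a,b\}=ab+ba$. $R$ is the reflection operator $Rf(x)=f(-x)$, $\mathbb{I}$ is the identity, and $\partial_xR$ means first apply $R$ and then differentiate, i.e. $(\partial_xRf)(x)=-f'(-x)$. Scalars in operator identities stand for multiples of $\mathbb{I}$. All operators may be regarded as acting on smooth functions on $\mathbb{R}\setminus\{0\}$. The operator $\mathcal{D}^{(\epsilon)}$ is $$\mathcal{D}^{(\epsilon)}=S_x\partial_x^2+T_x\partial_xR+U_x\partial_x+V_x(\mathbb{I}-R)$$ with coefficients $$S_x=\frac{(x^2-\gamma^2)(x^2-\gamma^2-1)}{4x^2},\qquad T_x=\frac{\gamma(x-\gamma)(x^2-\gamma^2-1)}{4x^3},$$ $$U_x=\frac{\gamma(x^2-\gamma^2-1)(2\gamma-x)}{4x^3}+\frac{(x^2-\gamma^2)(\alpha+\beta+3/2)}{2x}-\frac{\alpha+1/2}{2x},$$ $$V_x=\frac{\gamma(x^2-\gamma^2-1)(x-3\gamma/2)}{4x^4}-\frac{(x^2-\gamma^2)(\alpha+\beta+3/2)}{4x^2}+\frac{\alpha+1/2}{4x^2}+\epsilon\,\frac{x-\gamma}{2x}.$$ *)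

(* Defs.v *)
From Stdlib Require Import Reals.
From Coquelicot Require Import Coquelicot.
Open Scope R_scope.

(* A smooth function on R \ {0} is represented by a total function f : R -> R
   that is smooth at every x <> 0; its value at 0 is irrelevant. *)
Definition smooth_off0 (f : R -> R) : Prop :=
  forall (n : nat) (x : R), x <> 0 -> ex_derive_n f n x.

Definition operator : Type := (R -> R) -> (R -> R).

Definition op_id : operator := fun f => f.
Definition op_zero : operator := fun _ _ => 0.
Definition op_add (A B : operator) : operator := fun f x => A f x + B f x.
Definition op_sub (A B : operator) : operator := fun f x => A f x - B f x.
Definition op_scale (a : R) (A : operator) : operator := fun f x => a * A f x.
(* (A B) f = A (B f): the right factor acts first. *)
Definition op_mul (A B : operator) : operator := fun f => A (B f).
Definition op_fun (a : R -> R) : operator := fun f x => a x * f x.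
Definition op_deriv : operator := fun f => Derive f.
Definition op_refl : operator := fun f x => f (- x).

(* Equality of operators on smooth functions on R \ {0}.  All operators used
   below only see the values of f near x and near - x, hence never at 0. *)
Definition op_eq (A B : operator) : Prop :=
  forall f : R -> R, smooth_off0 f -> forall x : R, x <> 0 -> A f x = B f x.

Declare Scope op_scope.
Delimit Scope op_scope with op.
Bind Scope op_scope with operator.
Arguments op_add (A B)%_op f x%_R.
Arguments op_sub (A B)%_op f x%_R.
Arguments op_mul (A B)%_op f x%_R.
Arguments op_scale a%_R A%_op f x%_R.
Arguments op_eq (A B)%_op.
Notation "0" := op_zero : op_scope.
Notation "A + B" := (op_add A B) : op_scope.
Notation "A - B" := (op_sub A B) : op_scope.
Notation "A * B" := (op_mul A B) : op_scope.
Notation "a *: A" := (op_scale a A) (at level 40) : op_scope.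
Notation "A =op B" := (op_eq A B) (at level 70, no associativity) : type_scope.

Definition op_comm (A B : operator) : operator := (A * B - B * A)%op.
Definition op_anticomm (A B : operator) : operator := (A * B + B * A)%op.

Definition coefS (gamma x : R) : R :=
  (x ^ 2 - gamma ^ 2) * (x ^ 2 - gamma ^ 2 - 1) / (4 * x ^ 2).

Definition coefT (gamma x : R) : R :=
  gamma * (x - gamma) * (x ^ 2 - gamma ^ 2 - 1) / (4 * x ^ 3).

Definition coefU (alpha beta gamma x : R) : R :=
  gamma * (x ^ 2 - gamma ^ 2 - 1) * (2 * gamma - x) / (4 * x ^ 3)
  + (x ^ 2 - gamma ^ 2) * (alpha + beta + 3 / 2) / (2 * x)
  - (alpha + 1 / 2) / (2 * x).

Definition coefV (alpha beta gamma epsilon x : R) : R :=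
  gamma * (x ^ 2 - gamma ^ 2 - 1) * (x - 3 * gamma / 2) / (4 * x ^ 4)
  - (x ^ 2 - gamma ^ 2) * (alpha + beta + 3 / 2) / (4 * x ^ 2)
  + (alpha + 1 / 2) / (4 * x ^ 2)
  + epsilon * ((x - gamma) / (2 * x)).

Definition kappa1 (alpha beta gamma epsilon : R) : operator :=
  (op_fun (coefS gamma) * (op_deriv * op_deriv)
   + op_fun (coefT gamma) * (op_deriv * op_refl)
   + op_fun (coefU alpha beta gamma) * op_deriv
   + op_fun (coefV alpha beta gamma epsilon) * (op_id - op_refl))%op.

Definition kappa2 : operator := op_fun (fun x => x).

Definition opP (gamma : R) : operator :=
  (op_refl + op_fun (fun x => (gamma / x)%R) * (op_id - op_refl))%op.

Definition kappa3 (alpha beta gamma epsilon : R) : operator :=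
  op_comm (kappa1 alpha beta gamma epsilon) kappa2.

(* Main.v *)
Require Import Defs.
From Stdlib Require Import Reals Lra.
From Coquelicot Require Import Coquelicot.
Open Scope R_scope.

(* Every composition of the operators involved sends [f] to a combination of
   the derivatives of [f] at [x] and at [-x] whose coefficients are Laurent
   polynomials in [x].  Since [kappa1] has order two and [kappa3] turns out
   to have order one, every relation is an equality of two such combinations
   of order at most three, and holds coefficient by coefficient. *)

(** * Differentiation away from the origin *)

Definition derives_off0 (f g : R -> R) : Prop :=
  forall x, x <> 0 -> is_derive f x (g x).

(** The complement of 0 is open, so agreement off 0 is agreement near each point. This lets an
    operator applied to [f] be replaced by its explicit formula before differentiating. *)
Lemma derives_off0_ext (f g h : R -> R) :
  (forall x, x <> 0 -> f x = g x) -> derives_off0 f h -> derives_off0 g h.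
Proof.
  intros Hfg Hf x Hx.
  apply is_derive_ext_loc with f; [|now apply Hf].
  apply (filter_imp (fun y => y <> 0)); [exact Hfg|].
  exact (open_neq 0 x Hx).
Qed.

Lemma derives_off0_eq (f g h : R -> R) :
  derives_off0 f g -> (forall x, g x = h x) -> derives_off0 f h.
Proof. intros Hf Hgh x Hx. rewrite <- Hgh. now apply Hf. Qed.

Lemma derives_off0_plus (f g f' g' : R -> R) :
  derives_off0 f f' -> derives_off0 g g' ->
  derives_off0 (fun x => f x + g x) (fun x => f' x + g' x).
Proof. intros Hf Hg x Hx. exact (is_derive_plus f g x _ _ (Hf x Hx) (Hg x Hx)). Qed.

Lemma derives_off0_opp (f f' : R -> R) :
  derives_off0 f f' -> derives_off0 (fun x => - f x) (fun x => - f' x).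
Proof. intros Hf x Hx. exact (is_derive_opp f x _ (Hf x Hx)). Qed.

Lemma derives_off0_minus (f g f' g' : R -> R) :
  derives_off0 f f' -> derives_off0 g g' ->
  derives_off0 (fun x => f x - g x) (fun x => f' x - g' x).
Proof. intros Hf Hg x Hx. exact (is_derive_minus f g x _ _ (Hf x Hx) (Hg x Hx)). Qed.

Lemma derives_off0_mult (f g f' g' : R -> R) :
  derives_off0 f f' -> derives_off0 g g' ->
  derives_off0 (fun x => f x * g x) (fun x => f' x * g x + f x * g' x).
Proof.
  intros Hf Hg x Hx.
  exact (is_derive_mult f g x _ _ (Hf x Hx) (Hg x Hx) Rmult_comm).
Qed.

Lemma derives_off0_refl (f f' : R -> R) :
  derives_off0 f f' -> derives_off0 (fun x => f (- x)) (fun x => - f' (- x)).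
Proof.
  intros Hf x Hx.
  assert (Hx' : - x <> 0) by lra.
  generalize (is_derive_comp f Ropp x _ _ (Hf (- x) Hx')
                (is_derive_opp (fun y => y) x 1 (is_derive_id x))).
  intros H; refine (eq_ind _ (is_derive (fun y => f (- y)) x) H _ _).
  unfold scal, opp; simpl; unfold mult; simpl; ring.
Qed.

Lemma derives_off0_const (c : R) : derives_off0 (fun _ => c) (fun _ => 0).
Proof. intros x _; exact (is_derive_const c x). Qed.

Lemma derives_off0_id : derives_off0 (fun x => x) (fun _ => 1).
Proof. intros x _; exact (is_derive_id x). Qed.

(** This rule and the next handle the factor [gamma / x] of [opP], since [opP gamma f] has to be
    differentiated twice. *)
Lemma derives_off0_inv (c : R) :
  derives_off0 (fun x => c / x) (fun x => - c / x ^ 2).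
Proof. intros x Hx. auto_derive; [exact Hx|now field]. Qed.

Lemma derives_off0_inv2 (c : R) :
  derives_off0 (fun x => c / x ^ 2) (fun x => - (2 * c) / x ^ 3).
Proof.
  intros x Hx. auto_derive; [|now field].
  repeat apply Rmult_integral_contrapositive_currified; trivial; lra.
Qed.

(** The products of [kappa1] and [kappa3] involve [f] up to order three; the fourth derivative
    serves the second derivative of [kappa1 f] that [kappa3_eval] takes as input. *)
Lemma smooth_off0_derivatives (f : R -> R) :
  smooth_off0 f ->
  exists f1 f2 f3 f4 : R -> R,
    derives_off0 f f1 /\ derives_off0 f1 f2
    /\ derives_off0 f2 f3 /\ derives_off0 f3 f4.
Proof.
  intros Hf.
  assert (H : forall n, derives_off0 (Derive_n f n) (Derive_n f (S n))).
  { intros n x Hx. exact (Derive_correct _ _ (Hf (S n) x Hx)). }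
  exists (Derive_n f 1), (Derive_n f 2), (Derive_n f 3), (Derive_n f 4).
  exact (conj (H 0%nat) (conj (H 1%nat) (conj (H 2%nat) (H 3%nat)))).
Qed.

(** * First and second derivatives of the coefficients *)

(** These come from expanding each coefficient as a Laurent polynomial and differentiating termwise;
    for instance S = x^2/4 - (2 gamma^2 + 1)/4 + gamma^2 (gamma^2 + 1)/(4 x^2). *)
Definition coefS' (gamma x : R) : R :=
  x / 2 - gamma ^ 2 * (gamma ^ 2 + 1) / (2 * x ^ 3).

Definition coefS'' (gamma x : R) : R :=
  1 / 2 + 3 * gamma ^ 2 * (gamma ^ 2 + 1) / (2 * x ^ 4).

Definition coefT' (gamma x : R) : R :=
  gamma / 4 * (gamma / x ^ 2 + 2 * (gamma ^ 2 + 1) / x ^ 3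
               - 3 * gamma * (gamma ^ 2 + 1) / x ^ 4).

Definition coefT'' (gamma x : R) : R :=
  gamma / 4 * (- 2 * gamma / x ^ 3 - 6 * (gamma ^ 2 + 1) / x ^ 4
               + 12 * gamma * (gamma ^ 2 + 1) / x ^ 5).

Definition coefU' (alpha beta gamma x : R) : R :=
  gamma / 4 * (- 2 * gamma / x ^ 2 - 2 * (gamma ^ 2 + 1) / x ^ 3
               + 6 * gamma * (gamma ^ 2 + 1) / x ^ 4)
  + (alpha + beta + 3 / 2) / 2
  + ((alpha + beta + 3 / 2) * gamma ^ 2 + alpha + 1 / 2) / (2 * x ^ 2).

Definition coefU'' (alpha beta gamma x : R) : R :=
  gamma / 4 * (4 * gamma / x ^ 3 + 6 * (gamma ^ 2 + 1) / x ^ 4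
               - 24 * gamma * (gamma ^ 2 + 1) / x ^ 5)
  - ((alpha + beta + 3 / 2) * gamma ^ 2 + alpha + 1 / 2) / x ^ 3.

Definition coefV' (alpha beta gamma epsilon x : R) : R :=
  gamma / 4 * (- 1 / x ^ 2 + 3 * gamma / x ^ 3 + 3 * (gamma ^ 2 + 1) / x ^ 4
               - 6 * gamma * (gamma ^ 2 + 1) / x ^ 5)
  - ((alpha + beta + 3 / 2) * gamma ^ 2 + alpha + 1 / 2) / (2 * x ^ 3)
  + epsilon * gamma / (2 * x ^ 2).

Definition coefV'' (alpha beta gamma epsilon x : R) : R :=
  gamma / 4 * (2 / x ^ 3 - 9 * gamma / x ^ 4 - 12 * (gamma ^ 2 + 1) / x ^ 5
               + 30 * gamma * (gamma ^ 2 + 1) / x ^ 6)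
  + 3 * ((alpha + beta + 3 / 2) * gamma ^ 2 + alpha + 1 / 2) / (2 * x ^ 4)
  - epsilon * gamma / x ^ 3.

Ltac derive_rational :=
  let x := fresh "x" in
  let Hx := fresh "Hx" in
  intros x Hx; auto_derive;
  [ repeat split; trivial;
    repeat apply Rmult_integral_contrapositive_currified; trivial; lra
  | now field ].

Lemma coefS_derives (gamma : R) : derives_off0 (coefS gamma) (coefS' gamma).
Proof. unfold coefS, coefS'. derive_rational. Qed.

Lemma coefS'_derives (gamma : R) : derives_off0 (coefS' gamma) (coefS'' gamma).
Proof. unfold coefS', coefS''. derive_rational. Qed.

Lemma coefT_derives (gamma : R) : derives_off0 (coefT gamma) (coefT' gamma).
Proof. unfold coefT, coefT'. derive_rational. Qed.

Lemma coefT'_derives (gamma : R) : derives_off0 (coefT' gamma) (coefT'' gamma).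
Proof. unfold coefT', coefT''. derive_rational. Qed.

Lemma coefU_derives (alpha beta gamma : R) :
  derives_off0 (coefU alpha beta gamma) (coefU' alpha beta gamma).
Proof. unfold coefU, coefU'. derive_rational. Qed.

Lemma coefU'_derives (alpha beta gamma : R) :
  derives_off0 (coefU' alpha beta gamma) (coefU'' alpha beta gamma).
Proof. unfold coefU', coefU''. derive_rational. Qed.

Lemma coefV_derives (alpha beta gamma epsilon : R) :
  derives_off0 (coefV alpha beta gamma epsilon) (coefV' alpha beta gamma epsilon).
Proof. unfold coefV, coefV'. derive_rational. Qed.

Lemma coefV'_derives (alpha beta gamma epsilon : R) :
  derives_off0 (coefV' alpha beta gamma epsilon) (coefV'' alpha beta gamma epsilon).
Proof. unfold coefV', coefV''. derive_rational. Qed.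

(* The coefficients are recognised by name: unifying two different ones would
   unfold the arithmetic of [R] and not return. *)
Ltac find_derivative :=
  lazymatch goal with
  | |- derives_off0 (fun x => @?f x + @?g x) _ =>
      eapply (derives_off0_plus f g); find_derivative
  | |- derives_off0 (fun x => @?f x - @?g x) _ =>
      eapply (derives_off0_minus f g); find_derivative
  | |- derives_off0 (fun x => @?f x * @?g x) _ =>
      eapply (derives_off0_mult f g); find_derivative
  | |- derives_off0 (fun x => ?c / x) _ => apply (derives_off0_inv c)
  | |- derives_off0 (fun x => ?c / x ^ 2) _ => apply (derives_off0_inv2 c)
  | |- derives_off0 (fun x => - @?f x) _ =>
      eapply (derives_off0_opp f); find_derivative
  | |- derives_off0 (fun x => ?f (- x)) _ =>
      eapply (derives_off0_refl f); find_derivative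
  | |- derives_off0 (fun x => x) _ => exact derives_off0_id
  | |- derives_off0 (fun _ => ?c) _ => exact (derives_off0_const c)
  | |- derives_off0 (fun x => coefS _ x) _ => apply coefS_derives
  | |- derives_off0 (fun x => coefS' _ x) _ => apply coefS'_derives
  | |- derives_off0 (fun x => coefT _ x) _ => apply coefT_derives
  | |- derives_off0 (fun x => coefT' _ x) _ => apply coefT'_derives
  | |- derives_off0 (fun x => coefU _ _ _ x) _ => apply coefU_derives
  | |- derives_off0 (fun x => coefU' _ _ _ x) _ => apply coefU'_derives
  | |- derives_off0 (fun x => coefV _ _ _ _ x) _ => apply coefV_derives
  | |- derives_off0 (fun x => coefV' _ _ _ _ x) _ => apply coefV'_derives
  | |- _ => eassumption
  end.

(** * Explicit action of [kappa1], [kappa3] and [opP] *)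

Lemma kappa1_eval (alpha beta gamma epsilon : R) (f f1 f2 : R -> R) :
  derives_off0 f f1 -> derives_off0 f1 f2 ->
  forall x, x <> 0 ->
  kappa1 alpha beta gamma epsilon f x =
    coefS gamma x * f2 x - coefT gamma x * f1 (- x) + coefU alpha beta gamma x * f1 x
    + coefV alpha beta gamma epsilon x * (f x - f (- x)).
Proof.
  intros H H1 x Hx.
  assert (E2 : Derive (Derive f) x = f2 x).
  (* [Derive f] is known to equal [f1] only off 0, so the outer derivative is transferred by local
     agreement. *)
  { apply is_derive_unique. apply (derives_off0_ext f1); trivial.
    intros y Hy; symmetry; now apply is_derive_unique, H. }
  assert (ER : Derive (fun y => f (- y)) x = - f1 (- x)).
  { apply is_derive_unique. exact (derives_off0_refl f f1 H x Hx). }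
  assert (E1 : Derive f x = f1 x) by now apply is_derive_unique, H.
  unfold kappa1, op_add, op_mul, op_sub, op_fun, op_deriv, op_id, op_refl.
  rewrite E2, ER, E1. ring.
Qed.

(** Commuting with x lowers the order of the unreflected terms by one. As R anticommutes with x, the
    reflected terms double instead, which gives the factors 2x on T and V. *)
Lemma kappa3_eval (alpha beta gamma epsilon : R) (f f1 f2 : R -> R) :
  derives_off0 f f1 -> derives_off0 f1 f2 ->
  forall x, x <> 0 ->
  kappa3 alpha beta gamma epsilon f x =
    2 * coefS gamma x * f1 x + 2 * x * coefT gamma x * f1 (- x)
    + coefU alpha beta gamma x * f x
    + (2 * x * coefV alpha beta gamma epsilon x - coefT gamma x) * f (- x).
Proof.
  intros H H1 x Hx.
  unfold kappa3, op_comm, op_sub, op_mul, kappa2, op_fun at 1 2.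
  erewrite (kappa1_eval _ _ _ _ f) by eassumption.
  (* The two derivatives of [y * f y] are existential variables here, and [find_derivative]
     constructs them. *)
  erewrite (kappa1_eval _ _ _ _ (fun y => y * f y)); trivial;
    [|find_derivative|cbv beta; find_derivative].
  cbv beta. ring.
Qed.

Lemma opP_eval (gamma : R) (f : R -> R) (x : R) :
  opP gamma f x = f (- x) + gamma / x * (f x - f (- x)).
Proof. reflexivity. Qed.

(** The odd part of P f is minus that of f, so the gamma/x terms of the two factors cancel. *)
Lemma opP_involutive (gamma : R) : (opP gamma * opP gamma)%op =op op_id.
Proof.
  intros f _ x Hx. unfold op_mul, op_id. rewrite !opP_eval, Ropp_involutive.
  now field.
Qed.

(** R anticommutes with x, so only the gamma/x term contributes: gamma (I - R) + gamma (I + R) = 2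
    gamma. *)
Lemma anticomm_kappa2_opP (gamma : R) :
  op_anticomm kappa2 (opP gamma) =op (2 * gamma) *: op_id.
Proof.
  intros f _ x Hx.
  unfold op_anticomm, op_add, op_mul, op_scale, op_id, kappa2, op_fun.
  rewrite !opP_eval. now field.
Qed.

(** The derivative keeps the unsimplified shape produced by the sum, product and reflection rules,
    so that [find_derivative] matches it. *)
Lemma derives_off0_opP (gamma : R) (f f1 : R -> R) :
  derives_off0 f f1 ->
  derives_off0 (opP gamma f)
    (fun x => - f1 (- x) + (- gamma / x ^ 2 * (f x - f (- x))
                            + gamma / x * (f1 x - - f1 (- x)))).
Proof.
  intros H.
  apply (derives_off0_ext (fun x => f (- x) + gamma / x * (f x - f (- x))));
    [reflexivity|find_derivative].
Qed.

(** * The relations involving [kappa1] and [kappa3] *)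

Section Relations.

Variables alpha beta gamma epsilon : R.

Local Notation S := (coefS gamma).
Local Notation S' := (coefS' gamma).
Local Notation T := (coefT gamma).
Local Notation T' := (coefT' gamma).
Local Notation U := (coefU alpha beta gamma).
Local Notation U' := (coefU' alpha beta gamma).
Local Notation V := (coefV alpha beta gamma epsilon).
Local Notation V' := (coefV' alpha beta gamma epsilon).
Local Notation k1 := (kappa1 alpha beta gamma epsilon).
Local Notation k3 := (kappa3 alpha beta gamma epsilon).
Local Notation P := (opP gamma).

Ltac unfold_ops :=
  unfold op_comm, op_anticomm, op_sub, op_add, op_mul, op_scale, op_id, op_zero,
    kappa2, op_fun.

Ltac unfold_coefs :=
  unfold coefS, coefS', coefS'', coefT, coefT', coefT'',
    coefU, coefU', coefU'', coefV, coefV', coefV''.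

Lemma derives_off0_kappa1 (f f1 f2 f3 : R -> R) :
  derives_off0 f f1 -> derives_off0 f1 f2 -> derives_off0 f2 f3 ->
  derives_off0 (k1 f)
    (fun x => S' x * f2 x + S x * f3 x - (T' x * f1 (- x) + T x * - f2 (- x))
              + (U' x * f1 x + U x * f2 x)
              + (V' x * (f x - f (- x)) + V x * (f1 x - - f1 (- x)))).
Proof.
  intros H H1 H2.
  apply (derives_off0_ext
    (fun x => S x * f2 x - T x * f1 (- x) + U x * f1 x + V x * (f x - f (- x)))).
  - intros x Hx; symmetry; now apply (kappa1_eval _ _ _ _ f f1 f2).
  - find_derivative.
Qed.

(** The first-order terms match because x (x + gamma) T = gamma S: in [k3 * P] the coefficient of
    f'(x) vanishes and that of f'(-x) is -2 x^2 T / gamma when gamma is nonzero. *)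
Lemma comm_kappa3_kappa2 :
  let delta2 := alpha + beta + 3 / 2 - 2 * epsilon in
  let delta4 := (gamma ^ 2 + 1) / 2 in
  let delta5 := gamma ^ 2 * (alpha + beta + 3 / 2 - 2 * epsilon) + alpha + 1 / 2 in
  op_comm k3 kappa2 =op
    ((1 / 2) *: (kappa2 * kappa2) + delta2 *: (kappa2 * kappa2 * P)
     + (2 * gamma) *: (k3 * P) - delta5 *: P - delta4 *: op_id)%op.
Proof.
  intros delta2 delta4 delta5 f Hf x Hx.
  destruct (smooth_off0_derivatives f Hf) as (f1 & f2 & f3 & f4 & H0 & H1 & _ & _).
  unfold_ops.
  erewrite (kappa3_eval _ _ _ _ (P f)); trivial;
    [|exact (derives_off0_opP _ _ _ H0)|cbv beta; find_derivative].
  erewrite (kappa3_eval _ _ _ _ f) by eassumption.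
  erewrite (kappa3_eval _ _ _ _ (fun y => y * f y)); trivial;
    [|find_derivative|cbv beta; find_derivative].
  (* Once double negations are removed, the values of [f] and [f1] at [x] and [- x] are atoms for
     [field]. *)
  rewrite !opP_eval, !Ropp_involutive.
  unfold delta2, delta4, delta5; unfold_coefs. now field.
Qed.

Lemma derives_off0_kappa3 (f f1 f2 : R -> R) :
  derives_off0 f f1 -> derives_off0 f1 f2 ->
  derives_off0 (k3 f)
    (fun x => 2 * S' x * f1 x + 2 * S x * f2 x
              + ((2 * T x + 2 * x * T' x) * f1 (- x) + 2 * x * T x * - f2 (- x))
              + (U' x * f x + U x * f1 x)
              + ((2 * V x + 2 * x * V' x - T' x) * f (- x)
                 + (2 * x * V x - T x) * - f1 (- x))).
Proof.
  intros H H1.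
  apply (derives_off0_ext
    (fun x => 2 * S x * f1 x + 2 * x * T x * f1 (- x) + U x * f x
              + (2 * x * V x - T x) * f (- x))).
  - intros x Hx; symmetry; now apply (kappa3_eval _ _ _ _ f f1 f2).
  (* The raw derivative contains zero terms from the constant factors; they are cleared because this
     expression is differentiated again. *)
  - eapply derives_off0_eq; [find_derivative|]. intros x; cbv beta; ring.
Qed.

(** The second-order terms agree because S is even, and the first-order terms in f'(x) agree by x (x
    + gamma) T = gamma S. *)
Lemma comm_kappa1_opP : op_comm k1 P =op op_zero.
Proof.
  intros f Hf x Hx.
  destruct (smooth_off0_derivatives f Hf) as (f1 & f2 & f3 & f4 & H0 & H1 & _ & _).
  unfold_ops.
  erewrite (kappa1_eval _ _ _ _ (P f)); trivial;
    [|exact (derives_off0_opP _ _ _ H0)|cbv beta; find_derivative].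
  rewrite (opP_eval gamma (k1 f)).
  rewrite !(kappa1_eval _ _ _ _ f f1 f2) by (trivial; lra).
  rewrite !opP_eval, !Ropp_involutive.
  unfold_coefs. now field.
Qed.

(** Conceptually, since [k1] commutes with P, this anticommutator is [k1, {x, P}] = [k1, 2 gamma] =
    0; the proof checks it on coefficients. *)
Lemma anticomm_kappa3_opP : op_anticomm k3 P =op op_zero.
Proof.
  intros f Hf x Hx.
  destruct (smooth_off0_derivatives f Hf) as (f1 & f2 & f3 & f4 & H0 & H1 & _ & _).
  unfold_ops.
  erewrite (kappa3_eval _ _ _ _ (P f)); trivial;
    [|exact (derives_off0_opP _ _ _ H0)|cbv beta; find_derivative].
  rewrite (opP_eval gamma (k3 f)).
  rewrite !(kappa3_eval _ _ _ _ f f1 f2) by (trivial; lra).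
  rewrite !opP_eval, !Ropp_involutive.
  unfold_coefs. now field.
Qed.

(** Both products have third-order part 2 S^2 f'''(x) + 2 x S T f'''(-x), because S is even; the
    commutator thus has order at most two, like the right-hand side. *)
Lemma comm_kappa1_kappa3 :
  let delta1 := epsilon * (alpha + beta + 1 - epsilon) in
  let delta2 := alpha + beta + 3 / 2 - 2 * epsilon in
  op_comm k1 k3 =op
    ((1 / 2) *: op_anticomm k1 kappa2 - delta2 *: (k3 * P) - gamma *: (k1 * P)
     + delta1 *: kappa2 - (delta1 * gamma) *: P)%op.
Proof.
  intros delta1 delta2 f Hf x Hx.
  destruct (smooth_off0_derivatives f Hf) as (f1 & f2 & f3 & f4 & H0 & H1 & H2 & H3).
  unfold_ops.
  erewrite (kappa1_eval _ _ _ _ (k3 f)); trivial;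
    [|exact (derives_off0_kappa3 _ _ _ H0 H1)|cbv beta; find_derivative].
  erewrite (kappa1_eval _ _ _ _ (P f)); trivial;
    [|exact (derives_off0_opP _ _ _ H0)|cbv beta; find_derivative].
  erewrite (kappa3_eval _ _ _ _ (P f)); trivial;
    [|exact (derives_off0_opP _ _ _ H0)|cbv beta; find_derivative].
  erewrite (kappa1_eval _ _ _ _ (fun y => y * f y)); trivial;
    [|find_derivative|cbv beta; find_derivative].
  erewrite (kappa3_eval _ _ _ _ (k1 f)); trivial;
    [|exact (derives_off0_kappa1 _ _ _ _ H0 H1 H2)|cbv beta; find_derivative].
  rewrite !(kappa1_eval _ _ _ _ f f1 f2) by (trivial; lra).
  rewrite !(kappa3_eval _ _ _ _ f f1 f2) by (trivial; lra).
  rewrite !opP_eval, !Ropp_involutive.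
  unfold delta1, delta2; unfold_coefs. now field.
Qed.

End Relations.

Theorem mainTheorem2 :
  forall alpha beta gamma epsilon : R,
  let k1 := kappa1 alpha beta gamma epsilon in
  let k2 := kappa2 in
  let k3 := kappa3 alpha beta gamma epsilon in
  let P := opP gamma in
  let delta1 := epsilon * (alpha + beta + 1 - epsilon) in
  let delta2 := alpha + beta + 3 / 2 - 2 * epsilon in
  let delta3 := gamma in
  let delta4 := (gamma ^ 2 + 1) / 2 in
  let delta5 := gamma ^ 2 * (alpha + beta + 3 / 2 - 2 * epsilon) + alpha + 1 / 2 in
  P * P =op op_id
  /\ op_comm k3 k2 =op
       (1 / 2) *: (k2 * k2) + delta2 *: (k2 * k2 * P)
       + (2 * delta3) *: (k3 * P) - delta5 *: P - delta4 *: op_id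
  /\ op_comm k1 k3 =op
       (1 / 2) *: op_anticomm k1 k2 - delta2 *: (k3 * P) - delta3 *: (k1 * P)
       + delta1 *: k2 - (delta1 * delta3) *: P
  /\ op_comm k1 P =op 0
  /\ op_anticomm k2 P =op (2 * delta3) *: op_id
  /\ op_anticomm k3 P =op 0.
Proof.
  intros; repeat split.
  - apply opP_involutive.
  - apply comm_kappa3_kappa2.
  - apply comm_kappa1_kappa3.
  - apply comm_kappa1_opP.
  - apply anticomm_kappa2_opP.
  - apply anticomm_kappa3_opP.
Qed.
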